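(* The following sets are heroic: (1) $\{\overleftrightarrow{K_2}, \overrightarrow{C_3}, \overrightarrow{K_2}+K_1\}$; (2) $\{\overleftrightarrow{K_2}, K_4, P^+(3)\}$.
   Context: Digraphs have no loops and no parallel arcs, but both $xy$ and $yx$ may be arcs. The dichromatic number $\vec\chi(D)$ is the minimum number of colors in a vertex coloring of $D$ in which no color class induces a directed cycle. For a set $\mathcal F$ containing digraphs and possibly undirected graphs, $Forb_{ind}(\mathcal F)$ is the class of digraphs that contain, as an induced subdigraph, neither any digraph in $\mathcal F$ nor any orientation (oriented graph, i.e. at most one arc per pair) of any undirected graph in $\mathcal F$. $\mathcal F$ is heroic if $Forb_{ind}(\mathcal F)$ has bounded dichromatic number. $\overleftrightarrow{K_2}$ is the digon (two vertices, arcs in both directions); $\overrightarrow{C_3}$ is the directed cycle of length $3$; $\overrightarrow{K_2}+K_1$ is the disjoint union of a single arc and an isolated vertex; $K_4$ is the undirected complete graph on $4$ vertices (so all its orientations are forbidden); $P^+(3)$ is the directed path with $3$ arcs ($4$ vertices). *)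

(* Defs.v *)
From HB Require Import structures.
From mathcomp Require Import all_boot.
From mathcomp Require Import boolp.

Set Implicit Arguments.
Unset Strict Implicit.
Unset Printing Implicit Defensive.

Record digraph := Digraph {
  vertex :> finType;
  arc : rel vertex;
  arc_irr : irreflexive arc
}.

Record graph := Graph {
  gvertex :> finType;
  edge : rel gvertex;
  edge_sym : symmetric edge;
  edge_irr : irreflexive edge
}.

(* Directed cycles are nonempty, repetition-free cyclic sequences; those of
   length 1 are ruled out by arc_irr, and those of length 2 are digons. *)
Definition acyclic (D : digraph) (S : {set D}) : Prop :=
  forall c : seq D, c <> [::] -> {subset c <= S} -> ~ ucycle (@arc D) c.

Definition dicoloring (D : digraph) (k : nat) (f : D -> 'I_k) : Prop :=
  forall i : 'I_k, acyclic [set x | f x == i].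

Definition dicolorable (D : digraph) (k : nat) : Prop :=
  exists f : D -> 'I_k, dicoloring f.

Lemma dicolorable_card (D : digraph) : dicolorable D #|D|.
Proof.
exists enum_rank => i [//|x c] _ sub /andP[cyc /= /andP[xNc _]].
case: c => [|y c] in sub cyc xNc *.
  by move: cyc; rewrite /= arc_irr.
have /eqP ex : enum_rank x == i by have := sub x (mem_head _ _); rewrite inE.
have /eqP ey : enum_rank y == i.
  by have := sub y; rewrite !inE eqxx orbT; apply.
have xy : x = y by apply: enum_rank_inj; rewrite ex ey.
by rewrite xy mem_head in xNc.
Qed.

Lemma dicolorable_ex (D : digraph) : exists k, `[< dicolorable D k >].
Proof. by exists #|D|; apply/asboolP/dicolorable_card. Qed.

Definition dichromatic_number (D : digraph) : nat := ex_minn (dicolorable_ex D).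

Definition induced_subdigraph (H D : digraph) : Prop :=
  exists2 f : H -> D, injective f & forall x y, arc (f x) (f y) = arc x y.

Definition oriented (D : digraph) : Prop :=
  forall x y : D, ~~ (arc x y && arc y x).

(* The vertex set of an orientation of G is that of G up to a bijection. *)
Definition orientation (G : graph) (D : digraph) : Prop :=
  oriented D /\
  exists2 h : D -> G, bijective h &
    forall x y, edge (h x) (h y) = arc x y || arc y x.

Inductive forbidden :=
  | Directed of digraph
  | Undirected of graph.

Definition contains (D : digraph) (F : forbidden) : Prop :=
  match F with
  | Directed H => induced_subdigraph H D
  | Undirected G => exists2 H, orientation G H & induced_subdigraph H D
  end.

(* Plain predicates: the classical_sets type set lives in too small a universe
   to range over digraph. *)
Definition family := forbidden -> Prop.

Definition family3 (A B C : forbidden) : family :=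
  fun X => [\/ X = A, X = B | X = C].

Definition Forb_ind (F : family) (D : digraph) : Prop :=
  forall X, F X -> ~ contains D X.

Definition heroic (F : family) : Prop :=
  exists c : nat, forall D, Forb_ind F D -> dichromatic_number D <= c.

Definition complete_rel (n : nat) : rel 'I_n := fun x y => x != y.

Lemma complete_rel_sym n : symmetric (@complete_rel n).
Proof. by move=> x y; rewrite /complete_rel eq_sym. Qed.

Lemma complete_rel_irr n : irreflexive (@complete_rel n).
Proof. by move=> x; rewrite /complete_rel eqxx. Qed.

Definition complete_graph (n : nat) : graph :=
  Graph (@complete_rel_sym n) (@complete_rel_irr n).

Definition digon : digraph := Digraph (@complete_rel_irr 2).

Definition C3_rel : rel 'I_3 := fun x y => y == ordS x.

Lemma C3_rel_irr : irreflexive C3_rel.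
Proof. by case=> [[|[|[|]]]]. Qed.

Definition directed_C3 : digraph := Digraph C3_rel_irr.

Definition dipath_rel (n : nat) : rel 'I_n.+1 := fun x y => y == x.+1 :> nat.

Lemma dipath_rel_irr n : irreflexive (@dipath_rel n).
Proof. by move=> x; rewrite /dipath_rel ltn_eqF. Qed.

(* n counts the arcs: dipath n has n.+1 vertices. *)
Definition dipath (n : nat) : digraph := Digraph (@dipath_rel_irr n).

Definition disjoint_union_rel (D1 D2 : digraph) : rel (D1 + D2)%type :=
  fun u v =>
    match u, v with
    | inl x, inl y => arc x y
    | inr x, inr y => arc x y
    | _, _ => false
    end.

Lemma disjoint_union_rel_irr (D1 D2 : digraph) :
  irreflexive (@disjoint_union_rel D1 D2).
Proof. by case=> x /=; rewrite arc_irr. Qed.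

Definition disjoint_union (D1 D2 : digraph) : digraph :=
  Digraph (@disjoint_union_rel_irr D1 D2).

Definition single_arc : digraph := dipath 1.

Definition single_vertex : digraph := dipath 0.

(* Main.v *)
(** (1) Without an induced [K2 + K1], non-adjacency is transitive, so the
    digraph is an orientation of a complete multipartite graph.  Let [x] be a
    vertex and let [Q] be the set of vertices dominated by two adjacent vertices
    of the closed out-neighbourhood of [x].  If there are no digons and no
    directed triangles, then [Q] is closed under taking out-neighbours and
    misses [x].  The sink of a transitive triangle with source [x] lies in [Q],
    hence no path leads from this sink back to [x]: strong components contain no
    triangle.  Colouring each vertex according to its adjacency to a fixed
    vertex of its strong component therefore leaves no monochromatic arc inside
    a strong component.

    (2) Call [S] nice in [V] when each vertex of [S] lacks out-neighbours or
    lacks in-neighbours in [V \ S].  If every nonempty subset of [V] has a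
    nonempty nice subset that is [k]-dicolourable, then [V] is
    [2k]-dicolourable.  In a digraph without induced [P+(3)] whose
    neighbourhoods are [k]-dicolourable, a vertex together with its
    neighbourhood, second out-neighbourhood and second in-neighbourhood is nice
    when there is no directed triangle.  If [C] is a directed cycle and [X] the
    set of vertices having both an in- and an out-neighbour in [C], then [N(C)]
    together with [N(X)] is nice when no vertex is adjacent to all of [C]; this
    applies to directed triangles when there is no [K4].  These sets are
    themselves dicolourable with a number of colours linear in [k].  The
    argument is run twice, first for the neighbourhoods, whose neighbourhoods
    are stable, and then for the whole digraph. *)

From mathcomp Require Import all_boot.
From mathcomp Require Import boolp zify.
Require Import Defs.

Set Implicit Arguments.
Unset Strict Implicit.
Unset Printing Implicit Defensive.

Lemma cycle_closed (T : eqType) (e : rel T) (P : pred T) (c : seq T) :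
    cycle e c -> {in c &, forall x y, e x y -> P x -> P y} ->
  {in c &, forall x y, P x -> P y}.
Proof.
move=> cyc closedP x y xc yc.
have : cycle [rel u v | P u ==> P v] c.
  apply: (@sub_in_cycle _ (mem c) e) cyc; last exact/allP.
  by move=> u v uc vc uv; apply/implyP; apply: closedP uv.
rewrite cycle_all2rel => [/allrelP/(_ x y xc yc)/implyP //|].
by move=> v u w /implyP uv /implyP vw; apply/implyP => /uv/vw.
Qed.

Lemma connect_closed (T : finType) (e : rel T) (P : pred T) :
    (forall x y, e x y -> P x -> P y) ->
  forall x y, connect e x y -> P x -> P y.
Proof.
move=> closedP x _ /connectP[p + ->].
by elim: p x => //= z p IHp x /andP[/closedP xz /IHp zp] /xz.
Qed.

Section Adjacency.
Variable D : digraph.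
Implicit Types (b : bool) (x y z v w : D) (A V : {set D}).

Definition adj x y := arc x y || arc y x.

Lemma adjC x y : adj x y = adj y x.
Proof. by rewrite /adj orbC. Qed.

Lemma adjxx x : adj x x = false.
Proof. by rewrite /adj arc_irr. Qed.

Lemma arc_adj x y : arc x y -> adj x y.
Proof. by rewrite /adj => ->. Qed.

(* Each argument about out-neighbours is reused for in-neighbours by letting
   the direction [b] vary. *)
Definition darc b x y := if b then arc x y else arc y x.

Lemma darcN b x y : darc (~~ b) x y = darc b y x.
Proof. by case: b. Qed.

Lemma adj_darc b x y : adj x y = darc b x y || darc (~~ b) x y.
Proof. by case: b => //=; rewrite adjC. Qed.

Lemma darc_adj b x y : darc b x y -> adj x y.
Proof. by rewrite (adj_darc b) => ->. Qed.

Lemma adjP x y : reflect (exists b, darc b x y) (adj x y).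
Proof.
apply: (iffP orP) => [[xy|yx]|[[] xy]]; [|exists false|left|right] => //.
by exists true.
Qed.

Lemma cycle_closed_darc b (P : pred D) (c : seq D) :
    cycle (@arc D) c -> {in c &, forall x y, darc b x y -> P x -> P y} ->
  {in c &, forall x y, P x -> P y}.
Proof.
case: b => [|cyc closedP]; first exact: cycle_closed.
move=> x y xc yc Px; apply: contraTT (Px) => nPy.
apply: (cycle_closed (P := predC P) cyc _ yc xc nPy) => u v uc vc uv.
by apply: contraNN; apply: closedP.
Qed.

Lemma oriented_arcN x y : oriented D -> arc x y -> arc y x = false.
Proof. by move=> /(_ x y) + xy; rewrite xy => /negbTE. Qed.

Definition nbhd v := [set y | adj v y].

Definition nbhds A := \bigcup_(v in A) nbhd v.

Lemma nbhdsP A y : reflect (exists2 x, x \in A & adj x y) (y \in nbhds A).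
Proof.
by apply: (iffP bigcupP) => -[x xA xy]; exists x; rewrite // inE in xy *.
Qed.

Definition C3_free V :=
  {in V & &, forall x y z, arc x y -> arc y z -> ~~ arc z x}.

Lemma C3_free_darc b V :
    C3_free V ->
  {in V & &, forall x y z, darc b x y -> darc b y z -> ~~ darc b z x}.
Proof. by case: b => // c3 x y z xV yV zV xy yz; apply: c3 yz xy. Qed.

Definition clique_free n V :=
  forall s : seq D, size s = n -> {subset s <= V} -> ~~ pairwise adj s.

Lemma clique_freeS n A V : A \subset V -> clique_free n V -> clique_free n A.
Proof. by move=> /subsetP AV free s sn sA; apply: free => // x /sA/AV. Qed.

Lemma clique_free_leq m n V : m <= n -> clique_free m V -> clique_free n V.
Proof.
move=> mn free s sn sV.
have : ~~ pairwise adj (take m s).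
  by apply: free => [|x /mem_take/sV //]; rewrite size_takel ?sn.
by apply: contraNN; rewrite -{1}(cat_take_drop m s) pairwise_cat => /and3P[].
Qed.

Lemma clique_free_nbhd n V v :
  clique_free n.+1 V -> v \in V -> clique_free n (nbhd v :&: V).
Proof.
move=> free vV s sn sN; have: ~~ pairwise adj (v :: s).
  by apply: free => [|x]; rewrite ?inE /= ?sn // => /predU1P[->|/sN/setIP[]].
rewrite pairwise_cons negb_and => /orP[/allPn[x /sN]|//].
by rewrite !inE => /andP[->].
Qed.

Definition dipath3_free :=
  forall w x y z, arc w x -> arc x y -> arc y z ->
    [|| adj w y, adj x z | adj w z].

Lemma dipath3_free_darc b w x y z :
    dipath3_free -> darc b w x -> darc b x y -> darc b y z ->
  [|| adj w y, adj x z | adj w z].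
Proof.
case: b => p3 wx xy yz; first exact: p3.
by have := p3 _ _ _ _ yz xy wx; rewrite orbCA ![adj z _]adjC [adj y _]adjC.
Qed.

Definition complete_multipartite :=
  forall x y z, adj x y -> adj x z || adj y z.

End Adjacency.

Section Acyclic.
Variable D : digraph.
Implicit Types (b : bool) (x y : D) (A B : {set D}).

Lemma acyclicS A B : A \subset B -> acyclic B -> acyclic A.
Proof. by move=> /subsetP AB acB c c0 cA; apply: acB => // x /cA/AB. Qed.

Lemma acyclic_no_return A :
  {in A &, forall x y, arc x y -> ~~ connect (@arc D) y x} -> acyclic A.
Proof.
move=> noreturn [//|x c] _ cA /andP[cyc _].
have [y yc xy] : exists2 y, y \in x :: c & arc x y.
  exists (next (x :: c) x); first by rewrite mem_next mem_head.
  exact: next_cycle cyc (mem_head _ _).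
have /negP := noreturn x y (cA x (mem_head _ _)) (cA y yc) xy.
by apply; apply: connect_cycle cyc y x yc (mem_head _ _).
Qed.

Lemma acyclic_stable A : {in A &, forall x y, ~~ arc x y} -> acyclic A.
Proof.
move=> stable; apply: acyclic_no_return => x y xA yA.
by rewrite (negbTE (stable x y xA yA)).
Qed.

Lemma acyclicU_one_way b A B :
    {in A & B, forall x y, ~~ darc b x y} -> acyclic A -> acyclic B ->
  acyclic (A :|: B).
Proof.
move=> noarc acA acB c c0 cAB ucyc.
have /andP[cyc _] := ucyc.
have stayA : {in c &, forall x y, x \in A -> y \in A}.
  apply: (cycle_closed_darc (b := b) cyc) => x y _ /cAB/setUP[//|yB] xy xA.
  by have := noarc x y xA yB; rewrite xy.
have [/allP cA|/allPn[y yc yA]] := boolP (all (mem A) c); first exact: (acA c).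
apply: (acB c) ucyc => // x xc; have /setUP[xA|//] := cAB x xc.
by case/negP: yA; apply: (stayA x).
Qed.

End Acyclic.

Section SetDicolorable.
Variable D : digraph.
Implicit Types (b : bool) (x y : D) (A B S V W : {set D}).

Definition set_dicolorable A k : Prop :=
  exists2 F : nat -> {set D},
    forall i, acyclic (F i) & A \subset \bigcup_(i < k) F i.

Lemma dichromatic_number_le k :
  set_dicolorable [set: D] k -> dichromatic_number D <= k.
Proof.
case=> F acF /subsetP covF.
have color x : exists i : 'I_k, x \in F i.
  by have /bigcupP[i _ xi] := covF x (in_setT x); exists i.
rewrite /dichromatic_number; case: ex_minnP => m _; apply; apply/asboolP.
exists (fun x => xchoose (color x)) => i; apply: acyclicS (acF i).
by apply/subsetP => x; rewrite inE => /eqP <-; apply: (xchooseP (color x)).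
Qed.

Lemma set_dicolorableS A B k :
  A \subset B -> set_dicolorable B k -> set_dicolorable A k.
Proof. by move=> AB [F acF covF]; exists F => //; apply: subset_trans covF. Qed.

Lemma set_dicolorable_set0 k : set_dicolorable set0 k.
Proof.
exists (fun=> set0) => [_|]; last exact: sub0set.
by apply: acyclic_stable => x y; rewrite inE.
Qed.

Lemma set_dicolorable_acyclic A : acyclic A -> set_dicolorable A 1.
Proof. by move=> acA; exists (fun=> A); rewrite ?big_ord1. Qed.

Lemma set_dicolorableU A B j k :
    set_dicolorable A j -> set_dicolorable B k ->
  set_dicolorable (A :|: B) (j + k).
Proof.
move=> [F acF covF] [G acG covG].
exists (fun i => if i < j then F i else G (i - j)) => [i|]; first by case: ifP.
rewrite big_split_ord /=; under eq_bigr do rewrite ltn_ord.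
under [X in _ \subset _ :|: X]eq_bigr do rewrite ltnNge leq_addr addKn.
exact: setUSS.
Qed.

Lemma set_dicolorable_leq A j k :
  j <= k -> set_dicolorable A j -> set_dicolorable A k.
Proof.
move=> /subnKC <- /set_dicolorableU/(_ (set_dicolorable_set0 (k - j))).
by rewrite setU0.
Qed.

Lemma set_dicolorable_split A j k :
    set_dicolorable A (j + k) ->
  exists B, set_dicolorable (A :&: B) j /\ set_dicolorable (A :\: B) k.
Proof.
case=> F acF; rewrite big_split_ord /= => covF.
exists (\bigcup_(i < j) F i); split; first by exists F; rewrite ?subsetIr.
by exists (fun i => F (j + i)); rewrite // subDset.
Qed.

Lemma set_dicolorable_bigcup (I : finType) (P : {set I}) (F : I -> {set D}) k :
    {in P, forall i, set_dicolorable (F i) k} ->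
  set_dicolorable (\bigcup_(i in P) F i) (#|P| * k).
Proof.
move=> colF; rewrite -sum_nat_const.
apply: (big_ind2 set_dicolorable) => //; first exact: set_dicolorable_set0.
by move=> A j B l; apply: set_dicolorableU.
Qed.

Lemma set_dicolorableU_one_way b A B k :
    {in A & B, forall x y, ~~ darc b x y} ->
    set_dicolorable A k -> set_dicolorable B k ->
  set_dicolorable (A :|: B) k.
Proof.
move=> noarc [F acF covF] [G acG covG].
exists (fun i => (A :&: F i) :|: (B :&: G i)) => [i|].
  apply: (@acyclicU_one_way _ b) => [x y /setIP[xA _] /setIP[yB _]||].
  - exact: noarc.
  - exact: acyclicS (subsetIr _ _) (acF i).
  - exact: acyclicS (subsetIr _ _) (acG i).
by rewrite big_split -!big_distrr /= setUSS // subsetI subxx.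
Qed.

Definition nice S V : Prop :=
  {in S, forall x, exists b, {in V :\: S, forall y, ~~ darc b x y}}.

Definition has_nice_subset V k : Prop :=
  exists S, [/\ S \subset V, S != set0, nice S V & set_dicolorable S k].

(* The vertices of [S] without out-neighbours in [V :\: S] share the first [k]
   colours with [V :\: S], the others share the last [k] colours. *)
Lemma set_dicolorable_peel S V k :
    nice S V -> set_dicolorable S k -> set_dicolorable (V :\: S) k.*2 ->
  set_dicolorable V k.*2.
Proof.
move=> niceS colS; rewrite -addnn => /set_dicolorable_split[B [colI colD]].
pose half b := [set x in S | [forall y in V :\: S, ~~ darc b x y]].
have join b (R : {set D}) : R \subset V :\: S -> set_dicolorable R k ->
    set_dicolorable (half b :|: R) k.
  move=> /subsetP RV; apply: (@set_dicolorableU_one_way b).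
    by move=> x y; rewrite inE => /andP[_ /forall_inP noarc] /RV/noarc.
  by apply: set_dicolorableS colS; apply/subsetP => x; rewrite inE => /andP[].
apply: set_dicolorableS (set_dicolorableU
  (join true _ (subsetIl _ B) colI) (join false _ (subsetDl _ B) colD)).
apply/subsetP => x xV; have [xS|xS] := boolP (x \in S); last first.
  by rewrite !inE xS xV /=; case: (x \in B); rewrite ?orbT.
have [b /forall_inP xb] := niceS x xS; rewrite !in_setU.
by case: b xb => xb; apply/orP; [left|right]; apply/orP; left; rewrite inE xS.
Qed.

Lemma set_dicolorable_nice V k :
    (forall W, W \subset V -> W != set0 -> has_nice_subset W k) ->
  set_dicolorable V k.*2.
Proof.
have [n] := ubnP #|V|; elim: n V => // n IHn V; rewrite ltnS => Vn niceV.
have [->|V0] := eqVneq V set0; first exact: set_dicolorable_set0.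
have [S [SV S0 niceS colS]] := niceV V (subxx V) V0.
apply: set_dicolorable_peel niceS colS _; apply: IHn => [|W WV].
  apply: leq_trans Vn.
  by rewrite -(cardsID S V) (setIidPr SV) -[X in X < _]add0n ltn_add2r card_gt0.
by apply: niceV; apply: subset_trans WV (subsetDl _ _).
Qed.

End SetDicolorable.

Section Multipartite.
Variable D : digraph.
Hypotheses (orientedD : oriented D) (c3D : C3_free [set: D])
  (multipartiteD : complete_multipartite D).
Implicit Types x y z u v w : D.

Lemma arc_of_dipath2 u v w : arc u v -> arc v w -> adj u w -> arc u w.
Proof.
move=> uv vw /orP[//|wu].
by have := c3D (in_setT u) (in_setT v) (in_setT w) uv vw; rewrite wu.
Qed.

Definition closed_out_nbhd x := x |: [set u | arc x u].

Definition pair_dominated x : {set D} :=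
  [set y | [exists u in closed_out_nbhd x, exists v in closed_out_nbhd x,
              [&& adj u v, arc u y & arc v y]]].

Lemma pair_dominatedP x y :
  reflect (exists u v, [/\ u \in closed_out_nbhd x, v \in closed_out_nbhd x,
                           adj u v, arc u y & arc v y])
          (y \in pair_dominated x).
Proof.
rewrite inE; apply: (iffP exists_inP) => [[u xu /exists_inP[v xv /and3P[]]]|].
  by exists u, v.
move=> [u [v [xu xv uv uy vy]]]; exists u => //.
by apply/exists_inP; exists v; rewrite // uv uy.
Qed.

Lemma pair_dominated_closed x y z :
  arc y z -> y \in pair_dominated x -> z \in pair_dominated x.
Proof.
move=> yz /pair_dominatedP[u [v []]].
wlog uz : u v / adj u z => [conclude xu xv uv uy vy|xu _ _ uy _].
  have /orP[uz|vz] := multipartiteD z uv; first exact: (conclude u v).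
  by rewrite adjC in uv; apply: (conclude v u).
have {}uz : arc u z by apply: arc_of_dipath2 uz; first exact: uy.
have arc_via_u t : arc u t -> adj x t -> arc x t.
  case/setU1P: xu => [-> //|]; rewrite inE => xu ut.
  exact: arc_of_dipath2 xu ut.
apply/pair_dominatedP; have [xy|nxy] := boolP (adj x y).
  exists u, y; split; rewrite ?arc_adj //.
  by rewrite !inE arc_via_u ?orbT.
have xu' : arc x u.
  by case/setU1P: xu => [ux|]; [rewrite -ux arc_adj in nxy|rewrite inE].
exists u, x; split; rewrite ?setU11 1?adjC ?(arc_adj xu') //.
apply: arc_via_u => //; have := multipartiteD x (arc_adj yz).
by rewrite ![adj _ x]adjC (negbTE nxy).
Qed.

Lemma notin_pair_dominated x : x \notin pair_dominated x.
Proof.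
apply/pair_dominatedP => -[u [_ [/setU1P[->|xu] _ _ ux _]]].
  by rewrite arc_irr in ux.
by rewrite inE in xu; rewrite (oriented_arcN orientedD xu) in ux.
Qed.

Lemma transitive_triangle_no_return x y z :
  arc x y -> arc y z -> arc x z -> ~~ connect (@arc D) z x.
Proof.
move=> xy yz xz; apply: contra (notin_pair_dominated x) => zx.
apply: (connect_closed (@pair_dominated_closed x) zx).
apply/pair_dominatedP; exists x, y.
by split; rewrite ?setU11 ?(arc_adj xy) // !inE xy orbT.
Qed.

Definition strong x y := connect (@arc D) x y && connect (@arc D) y x.

Lemma strongxx x : strong x x.
Proof. by rewrite /strong connect0. Qed.

Lemma strongC x y : strong x y = strong y x.
Proof. exact: andbC. Qed.

Lemma strong_trans : transitive strong.
Proof.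
move=> y x z /andP[xy yx] /andP[yz zy].
by rewrite /strong (connect_trans xy yz) (connect_trans zy yx).
Qed.

Lemma strong_triangle_free x y z :
  strong x y -> strong x z -> adj x y -> adj x z -> ~~ adj y z.
Proof.
move=> sxy sxz; have szx : strong z x by rewrite strongC.
have szy : strong z y := strong_trans szx sxy.
have syz : strong y z by rewrite strongC.
have no_dipath2 u v w : strong u w -> arc u v -> arc v w -> adj u w -> False.
  move=> /andP[_ wu] uv vw /(arc_of_dipath2 uv vw) uw.
  by case/negP: (transitive_triangle_no_return uv vw uw).
move=> xy xz; apply/negP => yz.
have [yx zx zy] : [/\ adj y x, adj z x & adj z y].
  by rewrite ![adj z _]adjC adjC.
case/orP: (xy) => [axy|ayx]; case/orP: (xz) => [axz|azx].
- case/orP: (yz) => [ayz|azy]; first exact: (no_dipath2 x y z).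
  exact: (no_dipath2 x z y).
- exact: (no_dipath2 z x y).
- exact: (no_dipath2 y x z).
- case/orP: (yz) => [ayz|azy]; last exact: (no_dipath2 z y x).
  by apply: (no_dipath2 y z x); rewrite // strongC.
Qed.

Definition strong_repr x := choose (strong x) x.

Lemma strong_reprP x : strong x (strong_repr x).
Proof. exact/chooseP/strongxx. Qed.

Lemma strong_repr_eq x y : strong x y -> strong_repr x = strong_repr y.
Proof.
move=> sxy; have eqxy : strong x =1 strong y.
  by move=> z; apply/idP/idP; apply: strong_trans; rewrite // strongC.
rewrite /strong_repr (eq_choose eqxy).
by apply: choose_id; rewrite ?strongxx // strongC.
Qed.

Theorem set_dicolorable_multipartite : set_dicolorable [set: D] 2.
Proof.
pose same_side s := [set x | adj x (strong_repr x) == s].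
have acyclic_side s : acyclic (same_side s).
  apply: acyclic_no_return => x y; rewrite !inE => /eqP xs /eqP ys xy.
  apply/negP => yx; have sxy : strong x y by rewrite /strong connect1.
  have adj_xy := arc_adj xy.
  have := multipartiteD (strong_repr x) adj_xy.
  rewrite xs {1}(strong_repr_eq sxy) ys orbb => s_true.
  have := strong_triangle_free sxy (strong_reprP x) adj_xy.
  by rewrite xs (strong_repr_eq sxy) ys s_true => /(_ isT).
apply: set_dicolorableS (set_dicolorableU
  (set_dicolorable_acyclic (acyclic_side true))
  (set_dicolorable_acyclic (acyclic_side false))).
by apply/subsetP => x _; rewrite !inE; case: adj.
Qed.

End Multipartite.

Section Dipath3Free.
Variable D : digraph.
Hypothesis dipath3_freeD : dipath3_free D.
Implicit Types (b : bool) (x y z u v : D) (C V W : {set D}).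

Definition nbhd_dicolorable V k : Prop :=
  {in V, forall v, set_dicolorable (nbhd v :&: V) k}.

Lemma nbhd_dicolorableS W V k :
  W \subset V -> nbhd_dicolorable V k -> nbhd_dicolorable W k.
Proof.
move=> WV colV v /(subsetP WV)/colV; apply: set_dicolorableS.
exact: setIS.
Qed.

Definition second_nbhd b V v :=
  [set y in V | ~~ adj v y & [exists u in V, darc b v u && darc b u y]].

Lemma second_nbhdP b V v y :
  reflect [/\ y \in V, ~~ adj v y &
              exists2 u, u \in V & darc b v u /\ darc b u y]
          (y \in second_nbhd b V v).
Proof.
rewrite inE; apply: (iffP and3P) => -[yV nvy middle]; split=> //.
  by have /exists_inP[u uV /andP[]] := middle; exists u.
by have [u uV [vu uy]] := middle; apply/exists_inP; exists u; rewrite ?vu.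
Qed.

Lemma second_nbhd_closed b V v u x y :
    C3_free V -> u \in V -> x \in V -> y \in V ->
    darc b v u -> darc b u x -> darc b x y -> ~~ adj v x -> ~~ adj v y ->
  darc b u y.
Proof.
move=> c3 uV xV yV vu ux xy /negbTE nvx /negbTE nvy.
have := dipath3_free_darc dipath3_freeD vu ux xy.
rewrite nvx nvy orbF (adj_darc b) darcN.
by rewrite (negbTE (C3_free_darc c3 uV xV yV ux xy)) orbF.
Qed.

Lemma set_dicolorable_second_nbhd b V v k :
    C3_free V -> nbhd_dicolorable V k ->
  set_dicolorable (second_nbhd b V v) k.*2.
Proof.
move=> c3 colV; apply: set_dicolorable_nice => W /subsetP WN /set0Pn[y yW].
have /second_nbhdP[_ _ [u uV [vu uy]]] := WN y yW.
exists [set x in W | darc b u x]; split.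
- by apply/subsetP => x; rewrite inE => /andP[].
- by apply/set0Pn; exists y; rewrite inE yW.
- move=> x; rewrite inE => /andP[xW ux]; exists b => z.
  rewrite !inE => /andP[+ zW]; rewrite zW /=; apply: contraNN => xz.
  have /second_nbhdP[xV nvx _] := WN x xW.
  have /second_nbhdP[zV nvz _] := WN z zW.
  exact: (second_nbhd_closed c3 uV xV zV vu ux xz).
- apply: set_dicolorableS (colV u uV); apply/subsetP => x.
  rewrite !inE => /andP[xW /darc_adj->].
  by have /second_nbhdP[] := WN x xW.
Qed.

Definition second_ball V v :=
  v |: (nbhd v :&: V) :|: \bigcup_(b in [set: bool]) second_nbhd b V v.

Lemma nice_second_ball V v : C3_free V -> v \in V -> nice (second_ball V v) V.
Proof.
move=> c3 vV x xball.
have outside z : z \in V :\: second_ball V v ->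
    [/\ z \in V, ~~ adj v z & forall b, z \notin second_nbhd b V v].
  case/setDP => zV.
  rewrite in_setU negb_or in_setU1 negb_or in_setI zV andbT inE.
  move=> /andP[/andP[_ nvz] nz]; split=> // b; apply: contraNN nz => zb.
  by apply/bigcupP; exists b.
case/setUP: xball => [/setU1P[->|/setIP[]]|/bigcupP[b _]].
- by exists true => z /outside[_ nvz _]; apply: contraNN nvz; apply: darc_adj.
- rewrite inE => /adjP[b vx] xV; exists b => z /outside[zV nvz /(_ b)].
  by apply: contraNN => xz; apply/second_nbhdP; split=> //; exists x.
- move=> /second_nbhdP[xV nvx [u uV [vu ux]]].
  exists b => z /outside[zV nvz /(_ b)]; apply: contraNN => xz.
  apply/second_nbhdP; split=> //; exists u => //; split=> //.
  exact: (second_nbhd_closed c3 uV xV zV vu ux xz).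
Qed.

Lemma has_nice_subset_C3_free V k :
    C3_free V -> nbhd_dicolorable V k -> V != set0 ->
  has_nice_subset V (1 + 5 * k).
Proof.
move=> c3 colV /set0Pn[v vV]; exists (second_ball V v); split.
- rewrite !subUset sub1set vV subsetIr /=; apply/bigcupsP => b _.
  by apply/subsetP => y /second_nbhdP[].
- by apply/set0Pn; exists v; rewrite in_setU setU11.
- exact: nice_second_ball.
- have -> : 1 + 5 * k = 1 + k + #|[set: bool]| * k.*2.
    by rewrite cardsT card_bool; lia.
  apply: set_dicolorableU; last first.
    by apply: set_dicolorable_bigcup => b _; apply: set_dicolorable_second_nbhd.
  apply: set_dicolorableU (colV v vV).
  apply/set_dicolorable_acyclic/acyclic_stable.
  by move=> x y /set1P-> /set1P->; rewrite arc_irr.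
Qed.

Definition two_way_nbhd C := [set x | [forall b, [exists v in C, darc b x v]]].

Lemma two_way_nbhdP C x :
  reflect (forall b, exists2 v, v \in C & darc b x v) (x \in two_way_nbhd C).
Proof.
rewrite inE; apply: (iffP forallP) => twoC b.
  exact/exists_inP/twoC.
exact/exists_inP/twoC.
Qed.

Lemma two_way_nbhd_adj b C x y z :
    x \in two_way_nbhd C -> y \notin nbhds C -> z \notin nbhds C ->
    darc b x y -> darc b y z ->
  adj x z.
Proof.
move=> /two_way_nbhdP/(_ (~~ b))[v vC]; rewrite darcN => vx nyC nzC xy yz.
have nadj w : w \notin nbhds C -> adj v w = false.
  by apply: contraNF => vw; apply/nbhdsP; exists v.
by have := dipath3_free_darc dipath3_freeD vx xy yz; rewrite !nadj ?orbF.
Qed.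

Definition two_way_closure V C :=
  (nbhds C :|: nbhds (two_way_nbhd C :&: V)) :&: V.

Lemma set_dicolorable_nbhds_two_way C V k :
    nbhd_dicolorable V k ->
  set_dicolorable ((nbhds (two_way_nbhd C :&: V) :\: nbhds C) :&: V) k.*2.
Proof.
move=> colV; apply: set_dicolorable_nice => W /subsetP WN /set0Pn[y yW].
have /setIP[/setDP[/nbhdsP[x /setIP[xC xV] xy] _] _] := WN y yW.
exists (nbhd x :&: W); split.
- exact: subsetIr.
- by apply/set0Pn; exists y; rewrite !inE xy.
- move=> u /setIP[]; rewrite inE => /adjP[b xu] uW; exists b => z.
  rewrite in_setD in_setI inE => /andP[+ zW]; rewrite zW andbT.
  have /setIP[/setDP[_ nuC] _] := WN u uW.
  have /setIP[/setDP[_ nzC] _] := WN z zW.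
  by apply: contraNN; apply: (two_way_nbhd_adj xC nuC nzC xu).
- apply: set_dicolorableS (colV x xV); apply: setIS.
  by apply/subsetP => u /WN/setIP[].
Qed.

(* A vertex [z] off [N(C)] after [x] turns adjacency to [x] into a property that
   is inherited backwards along the arcs of [C]. *)
Lemma one_way_from_cycle (c : seq D) x (C := [set v in c]) :
    cycle (@arc D) c -> x \in nbhds C -> x \notin two_way_nbhd C ->
    (exists2 v, v \in c & ~~ adj v x) ->
  exists b, forall z, z \notin nbhds C -> ~~ darc b x z.
Proof.
move=> cyc /nbhdsP[u uC ux]; rewrite inE => /forallPn[b /exists_inPn noarc].
move=> [v vc nvx]; exists b => z nzC; apply: contraNN nvx => xz.
have nadj w : w \in C -> adj w z = false.
  by move=> wC; apply: contraNF nzC => wz; apply/nbhdsP; exists w.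
have into w : w \in C -> adj w x -> darc b w x.
  by move=> wC; rewrite (adj_darc b) darcN (negbTE (noarc w wC)) orbF.
rewrite inE in uC.
apply: (cycle_closed_darc (b := ~~ b) (P := [pred w | adj w x])
          cyc _ uC vc ux) => w w' wc w'c; rewrite darcN => w'w wx.
have [wC w'C] : w \in C /\ w' \in C by rewrite !inE.
have := dipath3_free_darc dipath3_freeD w'w (into w wC wx) xz.
by rewrite !nadj ?orbF.
Qed.

Lemma nice_two_way_closure (c : seq D) V (C := [set v in c]) :
    cycle (@arc D) c -> {in V, forall x, exists2 v, v \in c & ~~ adj v x} ->
  nice (two_way_closure V C) V.
Proof.
move=> cyc nodom x /setIP[xN xV].
have outside z : z \in V :\: two_way_closure V C ->
    z \notin nbhds C /\ {in two_way_nbhd C :&: V, forall w, ~~ adj w z}.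
  case/setDP=> zV; rewrite in_setI zV andbT in_setU negb_or => /andP[nzC nzX].
  by split=> // w wX; apply: contraNN nzX => wz; apply/nbhdsP; exists w.
have [xC|nxC] := boolP (x \in two_way_nbhd C).
  exists true => z /outside[_ /(_ x)]; rewrite in_setI xC xV => /(_ isT).
  by apply: contraNN; apply: darc_adj.
have [xNC|nxNC] := boolP (x \in nbhds C).
  have [b noarc] := one_way_from_cycle cyc xNC nxC (nodom x xV).
  by exists b => z /outside[nzC _]; apply: noarc.
move: xN; rewrite in_setU (negbTE nxNC) => /nbhdsP[w wX /adjP[b wx]].
exists b => z /outside[nzC /(_ w wX)]; apply: contraNN.
by case/setIP: wX => wC _; apply: two_way_nbhd_adj wC nxNC nzC wx.
Qed.

Lemma has_nice_subset_cycle (c : seq D) V k :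
    c != [::] -> {subset c <= V} -> cycle (@arc D) c ->
    {in V, forall x, exists2 v, v \in c & ~~ adj v x} ->
    nbhd_dicolorable V k ->
  has_nice_subset V ((size c + 2) * k).
Proof.
move=> c0 cV cyc nodom colV; pose C := [set v in c].
exists (two_way_closure V C); split.
- exact: subsetIr.
- case: c c0 @C cV cyc {nodom} => // u c _ C cV cyc.
  have vC : next (u :: c) u \in u :: c by rewrite mem_next mem_head.
  apply/set0Pn; exists (next (u :: c) u); rewrite in_setI cV // andbT in_setU.
  apply/orP; left; apply/nbhdsP; exists u; first by rewrite inE mem_head.
  exact/arc_adj/(next_cycle cyc)/mem_head.
- exact: nice_two_way_closure.
- have colC : set_dicolorable (\bigcup_(v in C) (nbhd v :&: V)) (#|C| * k).
    by apply: set_dicolorable_bigcup => v; rewrite inE => /cV/colV.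
  apply: set_dicolorable_leq (set_dicolorableS _
    (set_dicolorableU colC (set_dicolorable_nbhds_two_way C colV))).
    by rewrite mulnDl mul2n leq_add2r leq_mul2r cardsE card_size orbT.
  apply/subsetP => x /setIP[xN xV]; rewrite in_setU.
  have [/bigcupP[v vC vx]|nxC] := boolP (x \in nbhds C).
    by apply/orP; left; apply/bigcupP; exists v; rewrite // in_setI vx.
  by move: xN; rewrite !inE (negbTE nxC) xV andbT /= => ->; rewrite orbT.
Qed.

Lemma has_nice_subset_C3 V x y z k :
    clique_free 4 V -> x \in V -> y \in V -> z \in V ->
    arc x y -> arc y z -> arc z x -> nbhd_dicolorable V k ->
  has_nice_subset V (5 * k).
Proof.
move=> k4V xV yV zV xy yz zx colV.
have xyzV : {subset [:: x; y; z] <= V}.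
  by move=> u; rewrite !inE => /or3P[]/eqP->.
apply: (@has_nice_subset_cycle [:: x; y; z]) => //=; first by rewrite xy yz zx.
move=> u uV; apply/(allPn (a := [pred v | adj v u])).
apply: contraNN (k4V [:: u; x; y; z] erefl _) => [/= /and4P[xu yu zu _]|v].
  by rewrite ![adj u _]adjC [adj x z]adjC xu yu zu !arc_adj.
by move=> /predU1P[->|/xyzV].
Qed.

Lemma set_dicolorable_of_nbhd V k :
    clique_free 4 V -> nbhd_dicolorable V k ->
  set_dicolorable V (1 + 5 * k).*2.
Proof.
move=> k4V colV; apply: set_dicolorable_nice => W WV W0.
have colW := nbhd_dicolorableS WV colV; have k4W := clique_freeS WV k4V.
have [c3W|nc3W] := pselect (C3_free W); first exact: has_nice_subset_C3_free.
have [x [y [z [[xW yW zW] [xy yz zx]]]]] : exists x y z,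
    [/\ x \in W, y \in W & z \in W] /\ [/\ arc x y, arc y z & arc z x].
  apply: contrapT => noC3; apply: nc3W => x y z xW yW zW xy yz.
  by apply/negP => zx; apply: noC3; exists x, y, z.
have [S [SW S0 niceS colS]] := has_nice_subset_C3 k4W xW yW zW xy yz zx colW.
exists S; split=> //; apply: set_dicolorable_leq colS; exact: leq_addl.
Qed.

Lemma set_dicolorable_clique_freeS n k :
    n < 4 -> (forall V, clique_free n V -> set_dicolorable V k) ->
  forall V, clique_free n.+1 V -> set_dicolorable V (1 + 5 * k).*2.
Proof.
move=> n4 col_n V freeV; apply: set_dicolorable_of_nbhd.
  exact: clique_free_leq freeV.
by move=> v vV; apply/col_n/clique_free_nbhd.
Qed.

Theorem set_dicolorable_K4_free V : clique_free 4 V -> set_dicolorable V 122.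
Proof.
have col2 W : clique_free 2 W -> set_dicolorable W 1.
  move=> freeW; apply/set_dicolorable_acyclic/acyclic_stable => x y xW yW.
  have := freeW [:: x; y] erefl; rewrite /= !andbT => edge_free.
  apply: contraNN (edge_free _) => [/arc_adj //|z].
  by rewrite !inE => /orP[]/eqP->.
have col3 := @set_dicolorable_clique_freeS 2 1 isT col2.
exact: (@set_dicolorable_clique_freeS 3 12 isT col3).
Qed.

End Dipath3Free.

Definition twin_free (H : digraph) : Prop :=
  forall x y : H,
    (forall z, arc x z = arc y z) -> (forall z, arc z x = arc z y) -> x = y.

Lemma induced_subdigraph_twin_free (H D : digraph) (f : H -> D) :
    twin_free H -> (forall x y, arc (f x) (f y) = arc x y) ->
  induced_subdigraph H D.
Proof.
by move=> tfH arcf; exists f => // x y fxy; apply: tfH => z; rewrite -!arcf fxy.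
Qed.

Lemma digon_twin_free : twin_free digon.
Proof.
by move=> x y /(_ y) + _; rewrite /= /complete_rel eqxx => /negbFE/eqP.
Qed.

Lemma directed_C3_twin_free : twin_free directed_C3.
Proof.
move=> x y /(_ (ordS x)) + _; rewrite /= /C3_rel eqxx => /esym/eqP.
exact: ordS_inj.
Qed.

Lemma dipath_twin_free n : twin_free (dipath n).
Proof.
move=> x y outE _; wlog xy : x y outE / x < y => [lt_case|].
  have [xy|yx|/val_inj//] := ltngtP x y; first exact: lt_case.
  by apply/esym/lt_case.
have := outE (inord x.+1); rewrite /= /dipath_rel inordK ?eqxx.
  by move/esym/eqP => [/val_inj].
by rewrite ltnS (leq_trans xy) // -ltnS.
Qed.

Lemma disjoint_union_twin_free (H1 H2 : digraph) :
    (forall x : H1, exists y, adj x y) -> twin_free H1 -> twin_free H2 ->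
  twin_free (disjoint_union H1 H2).
Proof.
move=> no_isolated tf1 tf2 [x|x] [y|y] outE inE.
- by congr inl; apply: tf1 => z; [apply: (outE (inl z))|apply: (inE (inl z))].
- have [z /orP[xz|zx]] := no_isolated x.
    by have := outE (inl z); rewrite /= xz.
  by have := inE (inl z); rewrite /= zx.
- have [z /orP[yz|zy]] := no_isolated y.
    by have := outE (inl z); rewrite /= yz.
  by have := inE (inl z); rewrite /= zy.
- by congr inr; apply: tf2 => z; [apply: (outE (inr z))|apply: (inE (inr z))].
Qed.

Lemma single_arc_no_isolated (x : single_arc) : exists y, adj x y.
Proof. by exists (rev_ord x); case: x => [[|[|//]] ?]. Qed.

Section ForbiddenSubdigraphs.
Variable D : digraph.
Implicit Types w x y z : D.

Lemma digon_free_oriented : ~ contains D (Directed digon) -> oriented D.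
Proof.
move=> free x y; apply/negP => /andP[xy yx]; apply: free.
pose f (i : 'I_2) := nth x [:: x; y] i.
apply: (@induced_subdigraph_twin_free digon D f digon_twin_free).
by case=> [[|[|//]] ?] [[|[|//]] ?]; rewrite /f /= ?arc_irr ?xy ?yx.
Qed.

Hypothesis orientedD : oriented D.

Lemma directed_C3_free_C3_free :
  ~ contains D (Directed directed_C3) -> C3_free [set: D].
Proof.
move=> free x y z _ _ _ xy yz; apply/negP => zx; apply: free.
pose f (i : 'I_3) := nth x [:: x; y; z] i.
apply: (@induced_subdigraph_twin_free directed_C3 D f directed_C3_twin_free).
by case=> [[|[|[|//]]] ?] [[|[|[|//]]] ?];
  rewrite /f /= ?arc_irr ?xy ?yz ?zx // (oriented_arcN orientedD).
Qed.

Lemma arc_add_vertex_free_multipartite :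
    ~ contains D (Directed (disjoint_union single_arc single_vertex)) ->
  complete_multipartite D.
Proof.
move=> free; have arc_case x y z : arc x y -> adj x z || adj y z.
  move=> xy; apply: contra_notT free; rewrite !negb_or.
  move=> /andP[/andP[/negbTE xz /negbTE zx] /andP[/negbTE yz /negbTE zy]].
  pose f (v : 'I_2 + 'I_1) := if v is inl i then nth x [:: x; y] i else z.
  pose H := disjoint_union single_arc single_vertex.
  apply: (@induced_subdigraph_twin_free H D f); last first.
    case=> [[[|[|//]] ?]|[[|//] ?]] [[[|[|//]] ?]|[[|//] ?]];
    by rewrite /f /= ?arc_irr ?xy ?xz ?zx ?yz ?zy //
         (oriented_arcN orientedD xy).
  exact: disjoint_union_twin_free single_arc_no_isolated (@dipath_twin_free _)
    (@dipath_twin_free _).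
by move=> x y z /orP[/arc_case->//|/arc_case]; rewrite orbC.
Qed.

Lemma dipath_free_dipath3_free :
  ~ contains D (Directed (dipath 3)) -> dipath3_free D.
Proof.
move=> free w x y z wx xy yz; apply: contra_notT free; rewrite !negb_or.
move=> /and3P[/andP[/negbTE wy /negbTE yw] /andP[/negbTE xz /negbTE zx]].
move=> /andP[/negbTE wz /negbTE zw].
pose f (i : 'I_4) := nth w [:: w; x; y; z] i.
apply: (@induced_subdigraph_twin_free (dipath 3) D f (@dipath_twin_free 3)).
by case=> [[|[|[|[|//]]]] ?] [[|[|[|[|//]]]] ?];
  rewrite /f /= ?arc_irr ?wx ?xy ?yz ?wy ?yw ?xz ?zx ?wz ?zw //
    (oriented_arcN orientedD).
Qed.

Lemma complete_graph_free_clique_free n :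
  ~ contains D (Undirected (complete_graph n)) -> clique_free n [set: D].
Proof.
move=> free s sn _; apply/negP => clique_s; apply: free.
pose f (i : 'I_n) := tnth (Tuple (introT eqP sn)) i.
have adjf i j : adj (f i) (f j) = (i != j).
  have lt_adj (k l : 'I_n) : k < l -> adj (f k) (f l).
    move=> kl; rewrite /f !(tnth_nth (f k)).
    by apply: (pairwiseP (f k) clique_s) kl; rewrite inE sn.
  rewrite -val_eqE /=; have [/lt_adj->//|/lt_adj|/val_inj->] := ltngtP i j.
    by rewrite adjC.
  by rewrite adjxx.
pose H := @Digraph 'I_n (fun i j => arc (f i) (f j)) (fun i => arc_irr (f i)).
exists H.
  split=> [i j|]; first exact: orientedD.
  by exists id => [|i j]; [exists id|apply/esym/adjf].
exists f => // i j fij; apply/eqP.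
by rewrite -[_ == _]negbK -adjf fij adjxx.
Qed.

End ForbiddenSubdigraphs.

Theorem theorem8 :
  heroic (family3 (Directed digon)
                  (Directed directed_C3)
                  (Directed (disjoint_union single_arc single_vertex))) /\
  heroic (family3 (Directed digon)
                  (Undirected (complete_graph 4))
                  (Directed (dipath 3))).
Proof.
split; [exists 2|exists 122] => D free; apply: dichromatic_number_le;
  have orientedD := digon_free_oriented (free _ (Or31 _ _ erefl)).
- apply: (set_dicolorable_multipartite orientedD).
    exact: (directed_C3_free_C3_free orientedD (free _ (Or32 _ _ erefl))).
  exact: (arc_add_vertex_free_multipartite orientedD (free _ (Or33 _ _ erefl))).
- apply: set_dicolorable_K4_free.
    exact: (dipath_free_dipath3_free orientedD (free _ (Or33 _ _ erefl))).
  exact: (complete_graph_free_clique_free orientedD (free _ (Or32 _ _ erefl))).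
Qed.
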